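(* Let $p$ be a prime, let $k\geq 1$ be an integer, let $f\in F_p[x]$ be an irreducible polynomial of degree $k$, and let $K_f=F_p[x]/(f)$. Then the graph $X_f$ is connected and the directed graph $\overrightarrow{X}_f$ is strongly connected. Moreover, $X_f$ is Eulerian as an undirected graph and $\overrightarrow{X}_f$ is Eulerian as a directed graph. The diameter of $X_f$ is less than $2p(2k+1)-2k-4$, while that of $\overrightarrow{X}_f$ is less than $(p-1)(k^2+4k+1)+k$.
   Context: $F_p$ is the field with $p$ elements, and the class of the polynomial $x$ in $K_f=F_p[x]/(f)$ is again denoted $x$. Let $S=\{x,x^p,x^{p^2},\dots,x^{p^{k-1}}\}\subset K_f$ be the orbit of $x$ under the Frobenius automorphism $y\mapsto y^p$. The directed multigraph $\overrightarrow{X}_f$ has vertex set $K_f$ and the following edges. For all $y,z\in K_f$ and $s\in S$ with $z-y=s$ there is one (additive) edge from $y$ to $z$ corresponding to $s$. For all $y,z\in K_f\setminus\{0\}$ and $s\in S$ with $zy^{-1}=s$ there is one (multiplicative) edge from $y$ to $z$ corresponding to $s$. The undirected multigraph $X_f$ is obtained by forgetting the orientations of edges while keeping every edge (so multiple edges and loops may occur; a loop contributes $2$ to the degree of its vertex). Eulerian means having a closed walk (respectively a closed directed walk) that traverses every edge exactly once. The diameter of $X_f$ is the maximum over pairs of vertices of the length (number of edges) of a shortest path joining them; the diameter of $\overrightarrow{X}_f$ is the maximum over ordered pairs $(u,v)$ of vertices of the length of a shortest directed path from $u$ to $v$.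
   Formalization: The formal theorem assumes that f is not a nonzero scalar multiple of x; for f = cx (k = 1) the class of x is 0, S = {0}, the only edges are loops at the p vertices, and so the graphs are not connected. *)

(* Defs.v *)
From mathcomp Require Import all_boot all_order all_algebra all_field.
From mathcomp Require Import qpoly qfpoly.

Set Implicit Arguments.
Unset Strict Implicit.
Unset Printing Implicit Defensive.

Import GRing.Theory.
Local Open Scope ring_scope.

(* [step e u v] says that the edge e can be traversed from u to v. A walk from
   u is recorded as the sequence of its (edge, next vertex) pairs. *)
Section Walks.

Variables (V E : finType) (step : E -> V -> V -> bool).

Fixpoint walk (u : V) (w : seq (E * V)) : bool :=
  if w is (e, v) :: w' then step e u v && walk v w' else true.

Definition walk_vertices (u : V) (w : seq (E * V)) : seq V :=
  u :: [seq a.2 | a <- w].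

Definition walk_edges (w : seq (E * V)) : seq E := [seq a.1 | a <- w].

Definition walk_end (u : V) (w : seq (E * V)) : V := last u [seq a.2 | a <- w].

Definition path_between (u v : V) (w : seq (E * V)) : bool :=
  [&& walk u w, walk_end u w == v & uniq (walk_vertices u w)].

Definition all_joined : Prop := forall u v, exists w, path_between u v w.

Definition closed_eulerian_walk (u : V) (w : seq (E * V)) : Prop :=
  [/\ walk u w, walk_end u w = u
    & forall e : E, count_mem e (walk_edges w) = 1%N].

Definition has_eulerian_walk : Prop := exists u w, closed_eulerian_walk u w.

Definition is_distance (u v : V) (d : nat) : Prop :=
  (exists2 w, path_between u v w & size w = d)
  /\ (forall w, path_between u v w -> (d <= size w)%N).

(* Such a d exists only when all pairs of vertices are joined by a path. *)
Definition is_max_distance (d : nat) : Prop :=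
  (forall u v, exists2 d', is_distance u v d' & (d' <= d)%N)
  /\ (exists u v, is_distance u v d).

End Walks.

Record dimultigraph := DiMultigraph {
  dvertex : finType;
  darc : finType;
  dsource : darc -> dvertex;
  dtarget : darc -> dvertex
}.

(* The set of ends of an edge is a singleton exactly when the edge is a loop. *)
Record multigraph := Multigraph {
  mvertex : finType;
  medge : finType;
  mends : medge -> {set mvertex};
  mends_card : forall e, (0 < #|mends e| <= 2)%N
}.

Definition dstep (G : dimultigraph) (e : darc G) (u v : dvertex G) : bool :=
  (dsource e == u) && (dtarget e == v).

Definition mstep (G : multigraph) (e : medge G) (u v : mvertex G) : bool :=
  mends e == [set u; v].

Definition strongly_connected (G : dimultigraph) : Prop := all_joined (@dstep G).
Definition dieulerian (G : dimultigraph) : Prop := has_eulerian_walk (@dstep G).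
Definition is_didiameter (G : dimultigraph) (d : nat) : Prop :=
  is_max_distance (@dstep G) d.

Definition connected (G : multigraph) : Prop := all_joined (@mstep G).
Definition eulerian (G : multigraph) : Prop := has_eulerian_walk (@mstep G).
Definition is_diameter (G : multigraph) (d : nat) : Prop :=
  is_max_distance (@mstep G) d.

Lemma forget_ends_card (G : dimultigraph) (e : darc G) :
  (0 < #|[set dsource e; dtarget e]| <= 2)%N.
Proof. by rewrite cards2; case: (_ != _). Qed.

Definition forget_orientation (G : dimultigraph) : multigraph :=
  Multigraph (@forget_ends_card G).

Definition frobenius_orbit (p k : nat) (K : finFieldType) (x : K) : {set K} :=
  [set x ^+ (p ^ i) | i : 'I_k].

(* An edge is a triple (y, z, s): its source, its target and its label. *)
Definition additive_edge (K : finFieldType) (S : {set K}) : finType :=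
  {t : K * K * K | (t.2 \in S) && (t.1.2 - t.1.1 == t.2)}.

Definition multiplicative_edge (K : finFieldType) (S : {set K}) : finType :=
  {t : K * K * K | [&& t.1.1 != 0, t.1.2 != 0, t.2 \in S
                     & t.1.2 * t.1.1^-1 == t.2]}.

Definition edge_triple (K : finFieldType) (S : {set K})
    (e : additive_edge S + multiplicative_edge S) : K * K * K :=
  match e with inl a => val a | inr m => val m end.

Definition sum_product_digraph (K : finFieldType) (S : {set K}) : dimultigraph :=
  @DiMultigraph K (additive_edge S + multiplicative_edge S)%type
    (fun e => (edge_triple e).1.1) (fun e => (edge_triple e).1.2).

Section QuotientField.

Variables (F : finFieldType) (f : {poly F}).

(* [{poly %/ _}] requires a monic modulus; f and [monic_part] generate the
   same ideal. *)
Definition monic_part : {poly F} := (lead_coef f)^-1 *: f.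

Lemma monic_part_irreducible :
  irreducible_poly f -> monic_irreducible_poly monic_part.
Proof.
move=> hf; have f0 : lead_coef f != 0.
  by rewrite lead_coef_eq0 -size_poly_gt0 ltnW ?hf.1.
have c0 : (lead_coef f)^-1 != 0 by rewrite invr_eq0.
split; last by rewrite monicE lead_coefZ mulVf.
split; first by rewrite size_scale ?hf.1.
move=> q hq; rewrite dvdpZr // => /(hf.2 q hq) qf.
by rewrite eqp_sym (eqp_ltrans (eqp_scale f c0)) eqp_sym.
Qed.

Hypothesis hf : irreducible_poly f.

Definition quotient_field : finFieldType :=
  {poly %/ monic_part with monic_part_irreducible hf}.

Definition class_of_X : quotient_field := 'qX.

End QuotientField.

Definition Xdir (p k : nat) (f : {poly 'F_p}) (hf : irreducible_poly f) :
    dimultigraph :=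
  sum_product_digraph (frobenius_orbit p k (class_of_X hf)).

Definition Xundir (p k : nat) (f : {poly 'F_p}) (hf : irreducible_poly f) :
    multigraph :=
  forget_orientation (Xdir k hf).

(* Main.v *)
Require Import Defs.
From mathcomp Require Import all_boot all_order all_algebra all_field.
From mathcomp Require Import qpoly qfpoly zify ring.

(** The digraph contains every step [y -> y + x] and every step [y -> y * x]
    (the latter being trivial at [y = 0]).  Writing an element in the basis
    [x, x^2, ..., x^k] with digits less than p, Horner's scheme reaches it from
    0 in at most kp steps; cancelling the digits in the basis
    [x, 1, ..., x^(2-k)] one at a time leads from it to 0, again in at most kp
    steps.  So every directed distance, hence every undirected one, is at most
    2kp, which is less than both bounds.

    Every edge has a successor with the same label, starting where it ends, and
    this successor map is injective.  The in-degrees therefore do not exceed the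
    out-degrees, and a longest trail in such a strongly connected digraph is a
    closed Eulerian walk, which is also one of the undirected graph. *)

Set Implicit Arguments.
Unset Strict Implicit.
Unset Printing Implicit Defensive.

Import GRing.Theory.
Local Open Scope ring_scope.

(** * Bounded reachability, paths and the diameter *)

Section Reachability.

Variables (V E : finType) (step : E -> V -> V -> bool).

(** Vertices may repeat and the length is only bounded, so that these relations compose by
    concatenation; repetitions are removed once, in [reach_path]. *)
Definition reach (n : nat) (u v : V) : Prop :=
  exists w, [/\ walk step u w, walk_end u w = v & (size w <= n)%N].

Lemma reach_refl (u : V) : reach 0 u u.
Proof. by exists [::]. Qed.

Lemma reach_step (e : E) (u v : V) : step e u v -> reach 1 u v.
Proof. by move=> h; exists [:: (e, v)]; rewrite /= h. Qed.

Lemma reach_leq (m n : nat) (u v : V) : (m <= n)%N -> reach m u v -> reach n u v.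
Proof. by move=> mn [w [? ? wm]]; exists w; split=> //; apply: leq_trans mn. Qed.

Lemma walk_cat (u : V) (w1 w2 : seq (E * V)) :
  walk step u (w1 ++ w2) = walk step u w1 && walk step (walk_end u w1) w2.
Proof. by elim: w1 u => [|[e v] w1 IH] u //=; rewrite IH andbA. Qed.

Lemma reach_trans (m n : nat) (u v x : V) :
  reach m u v -> reach n v x -> reach (m + n) u x.
Proof.
move=> [w1 [h1 <- s1]] [w2 [h2 <- s2]]; exists (w1 ++ w2); split.
- by rewrite walk_cat h1.
- by rewrite /walk_end map_cat last_cat.
- by rewrite size_cat leq_add.
Qed.

Lemma path_suffix (x v u : V) (w : seq (E * V)) :
  path_between step x v w -> u \in walk_vertices x w ->
  exists2 w', path_between step u v w' & (size w' <= size w)%N.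
Proof.
elim: w x => [|[e y] w IH] x; first by rewrite inE => + /eqP->; exists [::].
move=> h; rewrite inE => /predU1P[-> | uw]; first by exists ((e, y) :: w).
have /IH/(_ uw)[w' hw' sw'] : path_between step y v w.
  by case/and3P: h => /andP[_ ? ?] /andP[_ ?]; apply/and3P.
by exists w' => //; apply: leqW.
Qed.

(** Loop erasure from the end of the walk: if the new first vertex already lies on the path built so
    far, the suffix starting there replaces that path. *)
Lemma reach_path (n : nat) (u v : V) :
  reach n u v -> exists2 w, path_between step u v w & (size w <= n)%N.
Proof.
case=> w [hw <- sw].
suff [w' hw' sw'] : exists2 w', path_between step u (walk_end u w) w'
    & (size w' <= size w)%N by exists w' => //; apply: leq_trans sw.
elim: w u hw {n sw} => [|[e x] w IH] u /=.
  by exists [::]; rewrite // /path_between /= /walk_end eqxx.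
case/andP=> st /IH[w' hw' sw'].
have [uw | uw] := boolP (u \in walk_vertices x w').
  by have [w2 h2 s2] := path_suffix hw' uw; exists w2 => //; lia.
exists ((e, x) :: w') => //; case/and3P: hw' => w1 w2 w3.
by apply/and3P; split; rewrite //= ?st // uw.
Qed.

Lemma reach_all_joined (n : nat) :
  (forall u v, reach n u v) -> all_joined step.
Proof. by move=> h u v; have [w] := reach_path (h u v); exists w. Qed.

Lemma reach_max_distance (n : nat) (u0 : V) :
  (forall u v, reach n u v) -> exists2 d, is_max_distance step d & (d <= n)%N.
Proof.
move=> h.
(* Fixing the length makes the existence of a path decidable, as [ex_minn] requires. *)
pose has_path u v m := [exists w : m.-tuple (E * V), path_between step u v w].
have ex u v : exists m, has_path u v m.
  have [w hw _] := reach_path (h u v); exists (size w).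
  by apply/existsP; exists (in_tuple w).
pose dist (q : V * V) := ex_minn (ex q.1 q.2).
have distP u v : is_distance step u v (dist (u, v)).
  rewrite /dist; case: ex_minnP => m /existsP[w hw] hm; split.
    by exists w => //; rewrite size_tuple.
  by move=> w' hw'; apply: hm; apply/existsP; exists (in_tuple w').
have dist_le q : (dist q <= n)%N.
  case: q => u v; have [_ dmin] := distP u v.
  by have [w hw sw] := reach_path (h u v); apply: leq_trans (dmin w hw) sw.
exists (\max_q dist q); last by apply/bigmax_leqP => q _.
split=> [u v|].
  by exists (dist (u, v)) => //; apply: leq_bigmax.
have [|[u v] ->] := @eq_bigmax _ dist; last by exists u, v.
by apply/card_gt0P; exists (u0, u0).
Qed.

End Reachability.

(** * Eulerian walks from a degree inequality *)

Section Euler.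

Variable G : dimultigraph.
Local Notation E := (darc G).
Local Notation V := (dvertex G).

Definition consecutive (e e' : E) : bool := dtarget e == dsource e'.

(** Each junction of the trail pairs a target with the next source; only the first source and the
    last target remain unpaired. *)
Lemma count_source_target (v : V) (e : E) (s : seq E) : path consecutive e s ->
  (count (fun a => dtarget a == v) (e :: s) + (dsource e == v) =
   count (fun a => dsource a == v) (e :: s) + (dtarget (last e s) == v))%N.
Proof.
elim: s e => [|a s IH] e /=; first by lia.
by case/andP=> /eqP ea /IH /=; rewrite ea; lia.
Qed.

Lemma path_walk (e : E) (s : seq E) : path consecutive e s ->
  walk (@dstep G) (dsource e) [seq (a, dtarget a) | a <- e :: s].
Proof.
elim: s e => [|a s IH] e /=; first by rewrite /dstep !eqxx.
case/andP=> /eqP ea /IH aw; rewrite /= in aw.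
by rewrite {1}/dstep !eqxx ea.
Qed.

Lemma exists_longest_trail : exists s : seq E,
  [/\ uniq s, sorted consecutive s
    & forall t, uniq t -> sorted consecutive t -> (size t <= size s)%N].
Proof.
pose P n := [exists s : n.-tuple E, uniq s && sorted consecutive s].
have P0 : exists n, P n by exists 0%N; apply/existsP; exists [tuple].
have PB n : P n -> (n <= #|E|)%N.
  case/existsP=> s /andP[us _]; rewrite cardE -(size_tuple s).
  by apply: uniq_leq_size => // e _; rewrite mem_enum.
case: (ex_maxnP P0 PB) => n /existsP[s /andP[us ss]] nmax.
exists s; split=> // t ut st; rewrite size_tuple; apply: nmax.
by apply/existsP; exists (in_tuple t); rewrite /= ut.
Qed.

Lemma eulerian_of_balanced (u0 : V) : strongly_connected G ->
  (forall v, #|[set e : E | dtarget e == v]| <=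
             #|[set e : E | dsource e == v]|)%N ->
  dieulerian G.
Proof.
move=> conn bal.
have [[|e s] [us ss smax]] := exists_longest_trail.
  (* If the longest trail is empty, there is no edge at all. *)
  exists u0, [::]; split=> // e.
  by have := smax [:: e] isT isT.
have extend a t : uniq t -> size t = size (e :: s) -> sorted consecutive t ->
    forall b, t = b :: behead t -> a \notin t ->
    consecutive (last b (behead t)) a -> False.
  move=> ut szt st b tb at_ lt; have := smax (rcons t a).
  rewrite rcons_uniq at_ ut size_rcons szt /= ltnn tb /=.
  by rewrite rcons_path lt andbT; rewrite tb in st; move=> /(_ isT st).
have closed : cycle consecutive (e :: s).
  have ps : path consecutive e s := ss.
  rewrite /= rcons_path ps /=; apply/negPn/negP => open.
  set v := dtarget (last e s).
  have [a /andP[/eqP av aes]] :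
      exists a : E, (dsource a == v) && (a \notin e :: s).
    apply/existsP; rewrite -[X in is_true X]negbK negb_exists.
    apply/negP => /forallP all_used.
    have := count_source_target v ps; rewrite eqxx.
    have -> : (dsource e == v) = false by rewrite eq_sym; apply: negbTE open.
    rewrite addn0 addn1.
    suff : (count (fun a => dtarget a == v) (e :: s) <=
            count (fun a => dsource a == v) (e :: s))%N by lia.
    have cnt (Q : pred E) : count Q (e :: s) = #|[set a in e :: s | Q a]|.
      rewrite -size_filter -(card_uniqP (filter_uniq Q us)).
      by apply: eq_card => b; rewrite !inE mem_filter inE andbC.
    rewrite !cnt.
    have -> : [set a in e :: s | dsource a == v] = [set a | dsource a == v].
      apply/setP => b; rewrite !inE; have := all_used b.
      rewrite negb_and negbK inE.
      by case: (dsource b == v); rewrite ?andbF // andbT.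
    apply: leq_trans (bal v); apply: subset_leq_card.
    by apply/subsetP => b; rewrite !inE => /andP[].
  apply: (extend a (e :: s) us erefl ss e erefl aes).
  by rewrite /consecutive /= av.
have all_out a b : a \in e :: s -> dsource b = dsource a -> b \in e :: s.
  move=> aes ba; apply/negPn/negP => bes.
  case: (rot_to aes) => i t rt.
  apply: (@extend b (rot i (e :: s))); rewrite ?rot_uniq ?size_rot ?mem_rot //.
  - by move: closed; rewrite -(rot_cycle i) rt /= rcons_path => /andP[].
  - by rewrite rt.
  - move: closed; rewrite -(rot_cycle i) rt /= rcons_path /consecutive ba.
    by case/andP.
(* Induction along a walk from [dsource e] to [v]: by [all_out] each of its edges is on the trail,
   and the next edge of the trail starts where that edge ends. *)
have visited v : exists2 a, a \in e :: s & dsource a = v.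
  have [w /and3P[hw /eqP <- _]] := conn (dsource e) v.
  have: exists2 a, a \in e :: s & dsource a = dsource e.
    by exists e; rewrite ?mem_head.
  elim: w (dsource e) hw => [|[b y] w IH] u //=.
  case/andP=> /andP[/eqP bu /eqP <-] hw [a ai au].
  apply: IH => //; exists (next (e :: s) b); last first.
    have bi : b \in e :: s by apply: (all_out a); rewrite ?bu.
    by have /eqP -> := next_cycle closed bi.
  by rewrite mem_next; apply: (all_out a); rewrite ?bu.
have all_used a : a \in e :: s.
  by have [b bi ba] := visited (dsource a); apply: all_out bi _.
exists (dsource e), [seq (a, dtarget a) | a <- e :: s]; split.
- exact: path_walk.
- rewrite /walk_end -map_comp /= last_map.
  by move: closed; rewrite /= rcons_path => /andP[_ /eqP].
- by move=> a; rewrite /walk_edges -map_comp map_id count_uniq_mem ?all_used.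
Qed.

End Euler.

(** * From directed walks to undirected ones *)

Section Forget.

Variable G : dimultigraph.

Lemma mstep_forget (e : darc G) (u v : dvertex G) :
  dstep e u v -> @mstep (forget_orientation G) e u v.
Proof. by case/andP=> /eqP <- /eqP <-; rewrite /mstep. Qed.

Lemma walk_forget (u : dvertex G) (w : seq (darc G * dvertex G)) :
  walk (@dstep G) u w -> walk (@mstep (forget_orientation G)) u w.
Proof.
elim: w u => [|[e v] w IH] u //= /andP[st /IH ->].
by rewrite (mstep_forget st).
Qed.

Lemma reach_forget (n : nat) (u v : dvertex G) :
  reach (@dstep G) n u v -> reach (@mstep (forget_orientation G)) n u v.
Proof. by case=> w [/walk_forget]; exists w. Qed.

Lemma eulerian_forget : dieulerian G -> eulerian (forget_orientation G).
Proof. by case=> u [w [/walk_forget]]; exists u, w. Qed.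

End Forget.

(** * Balance and short walks in the sum-product digraph *)

Section SumProduct.

Variables (K : finFieldType) (S : {set K}).
Local Notation G := (sum_product_digraph S).

Lemma add_edge_subproof (y s : K) : s \in S ->
  (s \in S) && (y + s - y == s).
Proof. by move=> ->; rewrite addrC addKr eqxx. Qed.

Definition add_edge (y s : K) (sS : s \in S) : additive_edge S :=
  exist (fun t : K * K * K => is_true ((t.2 \in S) && (t.1.2 - t.1.1 == t.2)))
    (y, y + s, s) (add_edge_subproof y sS).

Lemma mul_edge_subproof (y s : K) : y != 0 -> s != 0 -> s \in S ->
  [&& y != 0, y * s != 0, s \in S & y * s * y^-1 == s].
Proof. by move=> y0 s0 ->; rewrite y0 mulf_neq0 //= mulrC mulKf. Qed.

Definition mul_edge (y s : K) (y0 : y != 0) (s0 : s != 0) (sS : s \in S) :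
    multiplicative_edge S :=
  exist (fun t : K * K * K => is_true [&& t.1.1 != 0, t.1.2 != 0, t.2 \in S
                     & t.1.2 * t.1.1^-1 == t.2])
    (y, y * s, s) (mul_edge_subproof y0 s0 sS).

Lemma additive_label_in (e : additive_edge S) : (val e).2 \in S.
Proof. by case: e => t /= /andP[]. Qed.

Lemma multiplicative_label_in (e : multiplicative_edge S) : (val e).2 \in S.
Proof. by case: e => t /= /and4P[]. Qed.

Lemma multiplicative_target_neq0 (e : multiplicative_edge S) : (val e).1.2 != 0.
Proof. by case: e => t /= /and4P[]. Qed.

Lemma multiplicative_label_neq0 (e : multiplicative_edge S) : (val e).2 != 0.
Proof.
by case: e => t /= /and4P[y0 z0 _ /eqP <-]; rewrite mulf_neq0 ?invr_eq0.
Qed.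

Definition succ_edge (e : additive_edge S + multiplicative_edge S) :
    additive_edge S + multiplicative_edge S :=
  match e with
  | inl a => inl (add_edge (val a).1.2 (additive_label_in a))
  | inr m => inr (mul_edge (multiplicative_target_neq0 m)
                    (multiplicative_label_neq0 m) (multiplicative_label_in m))
  end.

Lemma source_succ_edge (e : darc G) : dsource (succ_edge e : darc G) = dtarget e.
Proof. by case: e. Qed.

(** The successor keeps the target and the label of an edge, and these determine its source, by
    subtraction or by division. *)
Lemma succ_edge_inj : injective succ_edge.
Proof.
move=> [] [[[y z] s] h] [] [[[y' z'] s'] h'] //= [] ez _ es.
- congr inl; apply: val_inj => /=; subst z' s'.
  case/andP: h h' => _ /= /eqP <- /andP[_ /= /eqP].
  by move/addrI/oppr_inj => ->.
- congr inr; apply: val_inj => /=; subst z' s'.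
  case/and4P: h h' => /= _ z0 _ /eqP <- /and4P[_ _ _ /= /eqP].
  by move/(mulfI z0)/invr_inj => ->.
Qed.

Lemma sum_product_balanced (v : K) :
  (#|[set e : darc G | dtarget e == v]| <=
   #|[set e : darc G | dsource e == v]|)%N.
Proof.
rewrite -(card_imset _ succ_edge_inj); apply: subset_leq_card.
by apply/subsetP=> _ /imsetP[e + ->]; rewrite !inE source_succ_edge.
Qed.

Variable x : K.
Hypotheses (xS : x \in S) (x0 : x != 0).
Local Notation reach := (reach (@dstep G)).

Lemma reach_add (y : K) : reach 1 y (y + x).
Proof.
apply: (@reach_step _ (darc G) _ (inl (add_edge y xS))).
by rewrite /dstep /= !eqxx.
Qed.

Lemma reach_addn (n : nat) (y : K) : reach n y (y + x *+ n).
Proof.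
elim: n => [|n IH]; first by rewrite mulr0n addr0; apply: reach_refl.
by rewrite mulrSr addrA -addn1; apply: reach_trans IH (reach_add _).
Qed.

Lemma reach_mul (y : K) : reach 1 y (y * x).
Proof.
(* No multiplicative edge leaves 0, but there the product is 0 and the empty walk serves. *)
have [->|y0] := eqVneq y 0.
  by rewrite mul0r; apply: reach_leq (reach_refl _ _).
apply: (@reach_step _ (darc G) _ (inr (mul_edge y0 x0 xS))).
by rewrite /dstep /= !eqxx.
Qed.

Variable p : nat.

(** Horner's scheme, with an overall factor [x] because only multiples of [x] are added. A digit
    costs one multiplication and at most [p - 1] additions. *)
Lemma reach_from0 (n : nat) (b : nat -> nat) : (forall i, b i < p)%N ->
  reach (n * p) 0 (x * \sum_(i < n) x ^+ i *+ b i).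
Proof.
elim: n b => [|n IH] b bp; first by rewrite big_ord0 mulr0; apply: reach_refl.
have -> : x * (\sum_(i < n.+1) x ^+ i *+ b i) =
    (x * (\sum_(i < n) x ^+ i *+ b i.+1)) * x + x *+ b 0%N.
  rewrite big_ord_recl expr0 mulrDr mulrnAr mulr1 addrC; congr (_ + _).
  rewrite -mulrA mulr_suml; congr (x * _).
  by apply: eq_bigr => i _; rewrite mulrnAl -exprSr.
apply: (@reach_leq _ _ _ (n * p + 1 + b 0%N)); first by have := bp 0%N; lia.
have step := IH (fun i => b i.+1) (fun i => bp i.+1).
exact: reach_trans (reach_trans step (reach_mul _)) (reach_addn _ _).
Qed.

(* The highest coefficient is cancelled first, so the exponents are shifted to
   make its term a multiple of [x] after each multiplication by [x]. *)
Lemma reach_to0 (n : nat) (b : nat -> nat) : (forall i, b i < p)%N ->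
  reach (n * p) (- (x ^+ 2 * (\sum_(i < n) x ^+ i *+ b i) / x ^+ n)) 0.
Proof.
move=> bp; elim: n => [|n IH].
  by rewrite big_ord0 mulr0 mul0r oppr0; apply: reach_refl.
set y := - _; set z := - _ in IH.
(* The term of index [n] in [y] is exactly [- (x *+ b n)]. *)
have yz : (y + x *+ b n) * x = z.
  have xn : x ^+ n != 0 by rewrite expf_neq0.
  rewrite /y /z big_ord_recr /= [x ^+ n.+1]exprS.
  by rewrite -(mulr_natr _ (b n)) -(mulr_natr x (b n)); field; rewrite x0 xn.
apply: (@reach_leq _ _ _ (b n + 1 + n * p)); first by have := bp n; lia.
apply: reach_trans IH; rewrite -yz.
exact: reach_trans (reach_addn _ _) (reach_mul _).
Qed.

Variable k : nat.
Hypothesis digits : forall z : K,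
  exists2 b : nat -> nat, (forall i, b i < p)%N & z = \sum_(i < k) x ^+ i *+ b i.

Lemma sum_product_reach (u v : K) : reach (k * p + k * p) u v.
Proof.
apply: (@reach_trans _ _ _ _ _ _ 0).
  (* The digits are chosen so that the starting point in [reach_to0] becomes [u]. *)
  have [b bp zb] := digits (- (u * x ^+ k / x ^+ 2)).
  have := reach_to0 k bp; rewrite -zb mulrN mulNr opprK.
  by rewrite [x ^+ 2 * _]mulrC mulfVK ?mulfK ?expf_neq0.
have [b bp zb] := digits (v / x).
by have := reach_from0 k bp; rewrite -zb mulrC divfK.
Qed.

End SumProduct.

(** * The class of the indeterminate and digit expansions *)

Section QuotientField.

Variables (F : finFieldType) (f : {poly F}) (hf : irreducible_poly f).
Local Notation h := (monic_part f).
Local Notation hI := (monic_part_irreducible hf).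

(** If the class is 0, the nonconstant [h] divides ['X] and so is associate to it. In that excluded
    case 0 is the only label: all edges are additive loops and the graph is disconnected. *)
Lemma class_of_X_neq0 : ~~ (f %= 'X) -> class_of_X hf != 0.
Proof.
apply: contraNneq => X0.
have : 'X %% h = 0.
  have [_ hm] := hI; rewrite Pdiv.IdomainMonic.modpE // -(mk_monicE hI).
  exact: (congr1 val (X0 : in_qpoly h 'X = 0)).
move/eqP; rewrite -/(dvdp h 'X); have [[h1 _] _] := hI => hX.
suff: h %= 'X.
  apply: eqp_trans; rewrite eqp_sym eqp_scale // invr_eq0 lead_coef_eq0.
  by rewrite -size_poly_gt0 ltnW ?hf.1.
rewrite -dvdp_size_eqp //; rewrite size_polyX eqn_leq h1 andbT.
by rewrite -(size_polyX F) dvdp_leq ?polyX_eq0.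
Qed.

End QuotientField.

(** The digits are the coefficients of the reduced representative of [z], read as natural numbers
    below [p]. *)
Lemma quotient_field_digits (p : nat) (hp : prime p) (f : {poly 'F_p})
    (hf : irreducible_poly f) (z : quotient_field hf) :
  exists2 b : nat -> nat, (forall i, b i < p)%N &
    z = \sum_(i < (size f).-1) class_of_X hf ^+ i *+ b i.
Proof.
pose h := monic_part f; pose hI := monic_part_irreducible hf.
have szh : size (mk_monic h) = size f.
  rewrite (mk_monicE hI) size_scale // invr_eq0 lead_coef_eq0.
  by rewrite -size_poly_gt0 ltnW ?hf.1.
pose q : {poly 'F_p} := val z.
exists (fun i => nat_of_ord q`_i) => [i|].
  by rewrite -[X in (_ < X)%N](Fp_cast hp) ltn_ord.
have zq : z = in_qpoly h q.
  have qE : in_qpoly h q = q :> {poly 'F_p}.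
    exact: in_qpoly_small (size_mk_monic (z : {poly %/ h})).
  exact: val_inj (esym qE).
have szq : (size q <= (size f).-1)%N by rewrite -szh; apply: size_npoly.
(* Padding with zero coefficients makes the number of digits independent of [z]. *)
have -> : z = in_qpoly h (\poly_(i < (size f).-1) q`_i).
  rewrite zq; congr in_qpoly; apply/polyP => i; rewrite coef_poly.
  by case: ltnP => // /(leq_trans szq) /leq_sizeP ->.
rewrite poly_def raddf_sum; apply: eq_bigr => i _.
(* A scalar of the prime field acts as a natural multiple. *)
rewrite -{1}[q`_i]natr_Zp scaler_nat raddfMn; congr (_ *+ _).
exact: (rmorphXn (in_qpoly h)).
Qed.

(** * Connectedness, Eulerian walks and diameters of the two graphs *)

Theorem theorem4 (p k : nat) (hp : prime p) (hk : (1 <= k)%N)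
    (f : {poly 'F_p}) (hf : irreducible_poly f) (hdeg : size f = k.+1)
    (hX : ~~ (f %= 'X)) :
  [/\ connected (Xundir k hf), strongly_connected (Xdir k hf),
      eulerian (Xundir k hf), dieulerian (Xdir k hf)
    & (exists2 d, is_diameter (Xundir k hf) d
         & (d < 2 * p * (2 * k + 1) - 2 * k - 4)%N)
      /\ (exists2 d, is_didiameter (Xdir k hf) d
            & (d < (p - 1) * (k ^ 2 + 4 * k + 1) + k)%N)].
Proof.
set x := class_of_X hf.
(* The label [x] is the member of its orbit with exponent [p ^ 0]. *)
have xS : x \in frobenius_orbit p k x.
  by apply/imsetP; exists (Ordinal hk); rewrite // expn0 expr1.
have x0 : x != 0 := class_of_X_neq0 hf hX.
have digits (z : quotient_field hf) : exists2 b : nat -> nat,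
    (forall i, b i < p)%N & z = \sum_(i < k) x ^+ i *+ b i.
  by have [b] := quotient_field_digits hp z; rewrite hdeg; exists b.
have dreach (u v : dvertex (Xdir k hf)) :
    reach (@dstep (Xdir k hf)) (k * p + k * p) u v :=
  sum_product_reach xS x0 digits u v.
have ureach (u v : mvertex (Xundir k hf)) :
    reach (@mstep (Xundir k hf)) (k * p + k * p) u v :=
  reach_forget (dreach u v).
have dconn : strongly_connected (Xdir k hf) := reach_all_joined dreach.
have deuler : dieulerian (Xdir k hf).
  apply: (eulerian_of_balanced (x : dvertex (Xdir k hf)) dconn) => v.
  exact: sum_product_balanced.
have p1 := prime_gt1 hp.
(* The two gaps are [2 (k + 1) (p - 1) - 2] and [(p - 1) (k + 1) ^ 2 - k], both positive for
   [p >= 2] and [k >= 1]. *)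
have bound : (k * p + k * p < 2 * p * (2 * k + 1) - 2 * k - 4)%N /\
    (k * p + k * p < (p - 1) * (k ^ 2 + 4 * k + 1) + k)%N.
  by rewrite expnS expn1; split; nia.
split; [exact: reach_all_joined ureach | exact: dconn
  | exact: eulerian_forget deuler | exact: deuler | split].
- have [d dd dle] := reach_max_distance (x : mvertex (Xundir k hf)) ureach.
  by exists d; [exact: dd | exact: leq_ltn_trans dle bound.1].
- have [d dd dle] := reach_max_distance (x : dvertex (Xdir k hf)) dreach.
  by exists d; [exact: dd | exact: leq_ltn_trans dle bound.2].
Qed.
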